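(* Let $\mathcal{C}$ be a category with a zero object, equipped with classes of fibrations, cofibrations and weak equivalences satisfying axioms (J1), (J2), (M1) and (M2) (for instance a pointed proper model category). Then for every object $X$ of $\mathcal{C}$, $$\mathrm{indcat}(X)=\mathrm{cat}(X).$$
   Context: **Setting.** $\mathcal{C}$ is a category with a zero object $0$ and three classes of morphisms: fibrations, cofibrations and weak equivalences. A trivial fibration (resp. trivial cofibration) is a fibration (resp. cofibration) that is also a weak equivalence. The axioms are: (J1) Isomorphisms are trivial cofibrations and trivial fibrations. Composites of fibrations (resp. cofibrations) are fibrations (resp. cofibrations). Given $f:X\to Y$ and $g:Y\to Z$, if two of $f,g,gf$ are weak equivalences, so is the third. (J2) For every fibration $p:E\to B$ and morphism $f:B'\to B$ the pull-back $E'$ exists, and the base extension $\overline p:E'\to B'$ is a fibration; if $f$ is a weak equivalence, so is its base extension $\overline f:E'\to E$; if $p$ is a weak equivalence, so is $\overline p$. Dually, for every cofibration $i:A\to B$ and morphism $f:A\to A'$ the push-out exists, and the cobase extension $\overline i$ of $i$ is a cofibration; if $f$ is a weak equivalence, so is its cobase extension $\overline f$; if $i$ is a weak equivalence, so is $\overline i$. (M1) In every commutative square with left side a cofibration $i:A\to X$ and right side a fibration $p:E\to B$, where $i$ or $p$ is a weak equivalence, there is a diagonal $X\to E$ making both triangles commute. (M2) Every morphism $f$ factors as $f=p\tau$ with $\tau$ a trivial cofibration and $p$ a fibration, and as $f=\sigma i$ with $i$ a cofibration and $\sigma$ a trivial fibration. An *$F$-factorization* of $f$ is a factorization $f=p\tau$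 with $\tau$ a weak equivalence and $p$ a fibration. A *$C$-factorization* is a factorization $f=\sigma i$ with $i$ a cofibration and $\sigma$ a weak equivalence. **Weak lifting, weak section.** For $f:A\to B$ and $g:C\to B$, $f$ *admits a weak lifting along $g$* if for some $F$-factorization $C\xrightarrow{\tau}E\xrightarrow{p}B$ of $g$ there is $s:A\to E$ with $ps=f$. $g$ *admits a weak section* if $\mathrm{id}_B$ admits a weak lifting along $g$. **Join.** Given $f:A\to B$ and $g:C\to B$, choose an $F$-factorization $g=p\tau$ with $p:E\to B$, form the pull-back $E'=A\times_B E$ with projections $\overline f:E'\to E$ and $\overline p:E'\to A$, choose a $C$-factorization $E'\xrightarrow{i}Z\xrightarrow{\sigma}E$ of $\overline f$, and let $A*_BC$ be the push-out of $\overline p$ and $i$. The join morphism $A*_BC\to B$ is induced by $f:A\to B$ and $p\sigma:Z\to B$. It is determined up to weak equivalence. **Ganea maps and cat.** For an object $B$, $p_0^B:G_0B=0\to B$ is the zero map, and for $n\ge1$, $p_n^B:G_nB=0*_BG_{n-1}B\to B$ is the join morphism of $0\to B$ and $p_{n-1}^B$. One says $\mathrm{cat}(B)\le n$ if and only if $p_n^B$ admits a weak section; $\mathrm{cat}(B)$ is the least such $n\ge 0$, and $\infty$ if there is none. **Domination.** A cofibrant model $QX$ of $X$ is obtained by factoring $0\to X$ as a cofibration $0\to QX$ followed by a trivial fibration $p_X:QX\to X$. A fibrant model $RY$ of $Y$ is obtained by factoring $Y\to 0$ as a trivial cofibration $i_Y:Y\to RY$ followed by a fibration $RY\to0$. $X$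 *dominates* $Y$, written $X\gg Y$, if for some cofibrant model $QX$ of $X$ and some fibrant model $RY$ of $Y$ there is a morphism $\alpha:QX\to RY$ such that $i_Y$ admits a weak lifting along $\alpha$. **Cofibre sequence.** For $f:A\to Y$, take a $C$-factorization of $A\to0$ as a cofibration $k:A\to CA$ followed by a weak equivalence $CA\to0$, and let $C$ be the push-out of $k$ and $f$, with $p:Y\to C$ the cobase extension of $k$. Then $A\xrightarrow{f}Y\xrightarrow{p}C$ is the cofibre sequence of $f$ (well defined up to weak equivalence). **Inductive category.** $\mathrm{indcat}(X)=0$ if and only if $0\to X$ admits a weak section. For $n\ge1$, $\mathrm{indcat}(X)\le n$ if and only if there is a cofibre sequence $A\to Y\to C$ with $\mathrm{indcat}(Y)\le n-1$ and $C\gg X$. $\mathrm{indcat}(X)$ is the least $n$ with $\mathrm{indcat}(X)\le n$, and $\infty$ if there is none. *)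

(* Defs.v *)
From mathcomp Require Import all_boot.
From mathcomp Require Import boolp.

Set Implicit Arguments.
Unset Strict Implicit.
Unset Printing Implicit Defensive.

Record category := Category {
  obj :> Type;
  hom : obj -> obj -> Type;
  idm : forall A, hom A A;
  comp : forall A B D, hom B D -> hom A B -> hom A D;
  comp1m : forall A B (f : hom A B), comp (idm B) f = f;
  compm1 : forall A B (f : hom A B), comp f (idm A) = f;
  compA : forall A B D E (h : hom D E) (g : hom B D) (f : hom A B),
    comp h (comp g f) = comp (comp h g) f
}.

Arguments hom {c} A B.
Arguments idm {c} A.
Arguments comp {c A B D} g f.

(* [g \c f] is composition in the usual order: first f, then g. *)
Notation "g \c f" := (comp g f) (at level 40, left associativity).

Definition is_iso (C : category) (A B : C) (f : hom A B) : Prop :=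
  exists g : hom B A, g \c f = idm A /\ f \c g = idm B.

(*       fbar
     E' -----> E
     |pbar     | p
     v         v
     B' -----> B
          f                                                                   *)
Definition is_pullback (C : category) (E B B' E' : C)
    (p : hom E B) (f : hom B' B) (fbar : hom E' E) (pbar : hom E' B') : Prop :=
  p \c fbar = f \c pbar /\
  forall (T : C) (u : hom T E) (v : hom T B'), p \c u = f \c v ->
    exists! w : hom T E', fbar \c w = u /\ pbar \c w = v.

(*        f
     A -----> A'
     | i      | ibar
     v        v
     B -----> B'
        fbar                                                                  *)
Definition is_pushout (C : category) (A B A' B' : C)
    (i : hom A B) (f : hom A A') (fbar : hom B B') (ibar : hom A' B') : Prop :=
  fbar \c i = ibar \c f /\
  forall (T : C) (u : hom B T) (v : hom A' T), u \c i = v \c f ->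
    exists! w : hom B' T, w \c fbar = u /\ w \c ibar = v.

(* Pull-backs and push-outs are only defined up to isomorphism, so an axiom
   about "the" base (cobase) extension is required of every pull-back
   (push-out) square. *)
Record jm_category := JMCategory {
  jm_base :> category;
  zero : jm_base;
  from0 : forall X : jm_base, hom zero X;
  to0 : forall X : jm_base, hom X zero;
  from0_unique : forall (X : jm_base) (f : hom zero X), f = from0 X;
  to0_unique : forall (X : jm_base) (f : hom X zero), f = to0 X;

  fib : forall A B : jm_base, hom A B -> Prop;
  cof : forall A B : jm_base, hom A B -> Prop;
  weq : forall A B : jm_base, hom A B -> Prop;

  J1_iso : forall (A B : jm_base) (f : hom A B), is_iso f ->
    [/\ fib f, cof f & weq f];
  J1_fib_comp : forall (A B D : jm_base) (f : hom A B) (g : hom B D),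
    fib f -> fib g -> fib (g \c f);
  J1_cof_comp : forall (A B D : jm_base) (f : hom A B) (g : hom B D),
    cof f -> cof g -> cof (g \c f);
  J1_weq_comp : forall (A B D : jm_base) (f : hom A B) (g : hom B D),
    weq f -> weq g -> weq (g \c f);
  J1_weq_right : forall (A B D : jm_base) (f : hom A B) (g : hom B D),
    weq f -> weq (g \c f) -> weq g;
  J1_weq_left : forall (A B D : jm_base) (f : hom A B) (g : hom B D),
    weq g -> weq (g \c f) -> weq f;

  J2_pullback : forall (E B B' : jm_base) (p : hom E B) (f : hom B' B),
    fib p -> exists (E' : jm_base) (fbar : hom E' E) (pbar : hom E' B'),
      is_pullback p f fbar pbar;
  J2_base_ext : forall (E B B' E' : jm_base) (p : hom E B) (f : hom B' B)
      (fbar : hom E' E) (pbar : hom E' B'),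
    fib p -> is_pullback p f fbar pbar ->
    [/\ fib pbar, (weq f -> weq fbar) & (weq p -> weq pbar)];
  J2_pushout : forall (A B A' : jm_base) (i : hom A B) (f : hom A A'),
    cof i -> exists (B' : jm_base) (fbar : hom B B') (ibar : hom A' B'),
      is_pushout i f fbar ibar;
  J2_cobase_ext : forall (A B A' B' : jm_base) (i : hom A B) (f : hom A A')
      (fbar : hom B B') (ibar : hom A' B'),
    cof i -> is_pushout i f fbar ibar ->
    [/\ cof ibar, (weq f -> weq fbar) & (weq i -> weq ibar)];

  M1_lift : forall (A X E B : jm_base) (i : hom A X) (p : hom E B)
      (u : hom A E) (v : hom X B),
    cof i -> fib p -> weq i \/ weq p -> p \c u = v \c i ->
    exists d : hom X E, d \c i = u /\ p \c d = v;

  M2_fact_fib : forall (A B : jm_base) (f : hom A B),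
    exists (E : jm_base) (tau : hom A E) (p : hom E B),
      [/\ f = p \c tau, cof tau, weq tau & fib p];
  M2_fact_cof : forall (A B : jm_base) (f : hom A B),
    exists (Z : jm_base) (i : hom A Z) (sigma : hom Z B),
      [/\ f = sigma \c i, cof i, fib sigma & weq sigma]
}.

Arguments zero {j}.
Arguments from0 {j} X.
Arguments to0 {j} X.
Arguments fib {j A B} _.
Arguments cof {j A B} _.
Arguments weq {j A B} _.

Section LSCategory.
Variable C : jm_category.

Definition F_factorization (A B E : C) (f : hom A B)
    (tau : hom A E) (p : hom E B) : Prop :=
  [/\ f = p \c tau, weq tau & fib p].

Definition C_factorization (A B Z : C) (f : hom A B)
    (i : hom A Z) (sigma : hom Z B) : Prop :=
  [/\ f = sigma \c i, cof i & weq sigma].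

Definition weak_lifting (A B D : C) (f : hom A B) (g : hom D B) : Prop :=
  exists (E : C) (tau : hom D E) (p : hom E B),
    F_factorization g tau p /\ exists s : hom A E, p \c s = f.

Definition weak_section (B D : C) (g : hom D B) : Prop :=
  weak_lifting (idm B) g.

(* j : J -> B is a join morphism of f and g, for some choice of the
   factorizations, of the pull-back and of the push-out. *)
Definition is_join (A B D : C) (f : hom A B) (g : hom D B)
    (J : C) (j : hom J B) : Prop :=
  exists (E : C) (tau : hom D E) (p : hom E B)
         (E' : C) (fbar : hom E' E) (pbar : hom E' A)
         (Z : C) (i : hom E' Z) (sigma : hom Z E)
         (inA : hom A J) (inZ : hom Z J),
    [/\ F_factorization g tau p,
        is_pullback p f fbar pbar,
        C_factorization fbar i sigma,
        is_pushout i pbar inZ inA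
      & j \c inA = f /\ j \c inZ = p \c sigma].

(* The join is determined only up to weak equivalence: a [join_choice] makes
   all the choices at once. The invariants below take it as a parameter. *)
Record join_choice := JoinChoice {
  join_obj : forall (A B D : C), hom A B -> hom D B -> C;
  join_map : forall (A B D : C) (f : hom A B) (g : hom D B),
    hom (join_obj f g) B;
  join_mapP : forall (A B D : C) (f : hom A B) (g : hom D B),
    is_join f g (join_map f g)
}.

Lemma join_exists (A B D : C) (f : hom A B) (g : hom D B) :
  exists (J : C) (j : hom J B), is_join f g j.
Proof.
have [E [tau [p [gE _ tau_weq p_fib]]]] := M2_fact_fib g.
have [E' [fbar [pbar pb]]] := J2_pullback f p_fib.
have [Z [i [sigma [fE i_cof _ sigma_weq]]]] := M2_fact_cof fbar.
have [J [inZ [inA po]]] := J2_pushout pbar i_cof.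
have comm : (p \c sigma) \c i = f \c pbar by rewrite -compA -fE; case: pb.
have [j [[jZ jA] _]] := po.2 _ _ _ comm.
exists J, j, E, tau, p, E', fbar, pbar, Z, i, sigma, inA, inZ.
by split.
Qed.

Lemma join_choice_inhabited : inhabited join_choice.
Proof.
pose J A B D (f : hom A B) (g : hom D B) := cid (join_exists f g).
pose j A B D (f : hom A B) (g : hom D B) := cid (projT2 (J A B D f g)).
exact: (inhabits (@JoinChoice (fun A B D f g => projT1 (J A B D f g))
  (fun A B D f g => projT1 (j A B D f g))
  (fun A B D f g => projT2 (j A B D f g)))).
Qed.

Fixpoint ganea (K : join_choice) (B : C) (n : nat) : {G : C & hom G B} :=
  match n with
  | 0 => existT (fun G : C => hom G B) zero (from0 B)
  | m.+1 => existT (fun G : C => hom G B)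
              (join_obj K (from0 B) (projT2 (ganea K B m)))
              (join_map K (from0 B) (projT2 (ganea K B m)))
  end.

Definition ganea_obj (K : join_choice) (B : C) (n : nat) : C :=
  projT1 (ganea K B n).

Definition ganea_map (K : join_choice) (B : C) (n : nat) :
    hom (ganea_obj K B n) B :=
  projT2 (ganea K B n).

Definition cat_le (K : join_choice) (X : C) (n : nat) : Prop :=
  weak_section (ganea_map K X n).

(* Since zero is initial (terminal), the two models below are automatically
   factorizations of the map from (to) zero. *)
Definition is_cofibrant_model (X Q : C) (q : hom Q X) : Prop :=
  [/\ cof (from0 Q), fib q & weq q].

Definition is_fibrant_model (Y R : C) (i : hom Y R) : Prop :=
  [/\ cof i, weq i & fib (to0 R)].

Definition dominates (X Y : C) : Prop :=
  exists (Q : C) (q : hom Q X) (R : C) (i : hom Y R),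
    [/\ is_cofibrant_model q, is_fibrant_model i
      & exists alpha : hom Q R, weak_lifting i alpha].

Definition is_cofibre_sequence (A Y D : C) (f : hom A Y) (p : hom Y D) : Prop :=
  exists (CA : C) (k : hom A CA) (e : hom CA zero) (fbar : hom CA D),
    C_factorization (to0 A) k e /\ is_pushout k f fbar p.

Fixpoint indcat_le (X : C) (n : nat) : Prop :=
  match n with
  | 0 => weak_section (from0 X)
  | m.+1 => exists (A Y D : C) (f : hom A Y) (p : hom Y D),
      [/\ is_cofibre_sequence f p, indcat_le Y m & dominates D X]
  end.

End LSCategory.

(* The least n with P n, as an extended natural number; [None] is infinity. *)
Definition least (P : nat -> Prop) : option nat :=
  if pselect (exists n, `[< P n >]) is left exP then Some (ex_minn exP)
  else None.

Definition cat (C : jm_category) (K : join_choice C) (X : C) : option nat :=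
  least (cat_le K X).

Definition indcat (C : jm_category) (X : C) : option nat :=
  least (indcat_le X).

(* Main.v *)
(* Weak lifting behaves as a preorder on maps into a fixed base as soon as the
   last source is cofibrant, and Ganea objects, being push-outs of cofibrations
   over zero, are cofibrant. Hence, without a cube axiom, joins and Ganea maps
   are natural up to weak lifting, and cat is invariant under weak equivalence
   and decreases under domination. If A -> Y -> D is a cofibre sequence, a lift
   of Y -> D to G_n D and the null-homotopy of A -> D glue to a weak section of
   G_{n+1} D -> D; so cat D <= cat Y + 1 and cat <= indcat. Conversely G_{n+1} X
   is the cofibre of the fibre inclusion into G_n X, which gives
   indcat (G_n X) <= n, and a weak section of a Ganea map is a domination. *)
From mathcomp Require Import all_boot.
From mathcomp Require Import boolp.
Require Import Defs.

Set Implicit Arguments.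
Unset Strict Implicit.
Unset Printing Implicit Defensive.

(** * Pasting of pull-backs and, by duality, of push-outs *)

Section Pasting.

Lemma pullback_sym (C : category) (E B B' E' : C) (p : hom E B)
    (f : hom B' B) (fbar : hom E' E) (pbar : hom E' B') :
  is_pullback p f fbar pbar -> is_pullback f p pbar fbar.
Proof.
move=> [sq univ]; split=> [|T u v e]; first by rewrite sq.
have [w [[w1 w2] wU]] := univ T v u (esym e).
by exists w; split=> // w' [w1' w2']; apply: wU.
Qed.

Lemma pullback_paste (C : category) (E B B1 B2 E1 E2 : C) (p : hom E B)
    (f : hom B1 B) (g : hom B2 B1) (fbar : hom E1 E) (pbar : hom E1 B1)
    (gbar : hom E2 E1) (pbar2 : hom E2 B2) :
  is_pullback p f fbar pbar -> is_pullback pbar g gbar pbar2 ->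
  is_pullback p (f \c g) (fbar \c gbar) pbar2.
Proof.
move=> [sq1 univ1] [sq2 univ2]; split=> [|T u v e].
  by rewrite compA sq1 -compA sq2 compA.
have [|w1 [[w11 w12] w1U]] := univ1 T u (g \c v); first by rewrite e compA.
have [w [[w21 w22] wU]] := univ2 T w1 v w12.
exists w; split=> [|w' [w1' w2']]; first by rewrite -compA w21.
apply: wU; split=> //; apply/esym/w1U.
by rewrite compA w1' compA sq2 -compA w2'.
Qed.

(** This half of the pasting law exhibits comparison maps as base extensions (dually, cobase
    extensions), so that (J2) applies to them. *)
Lemma pullback_cancel (C : category) (E B B1 B2 E1 E2 : C) (p : hom E B)
    (f : hom B1 B) (g : hom B2 B1) (fbar : hom E1 E) (pbar : hom E1 B1)
    (h : hom E2 E) (gbar : hom E2 E1) (pbar2 : hom E2 B2) :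
  is_pullback p f fbar pbar -> is_pullback p (f \c g) h pbar2 ->
  fbar \c gbar = h -> pbar \c gbar = g \c pbar2 ->
  is_pullback pbar g gbar pbar2.
Proof.
move=> [sq1 univ1] [sq2 univ2] gE pE; split=> // T u v e.
have [|w [[w1 w2] wU]] := univ2 T (fbar \c u) v.
  by rewrite compA sq1 -compA e compA.
exists w; split=> [|w' [w1' w2']].
  split=> //; have [|x [_ xU]] := univ1 T (fbar \c u) (pbar \c u).
    by rewrite !compA sq1.
  apply: etrans (esym (xU _ _)) (xU _ _); split=> //; first by rewrite compA gE.
  by rewrite compA pE -compA w2.
by apply: wU; split=> //; rewrite -gE -compA w1'.
Qed.

(* A push-out in [C] is definitionally a pull-back in the opposite category. *)
Definition opposite (C : category) : category :=
  @Category C (fun A B => hom B A) (@idm C) (fun A B D g f => f \c g)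
    (fun A B f => compm1 f) (fun A B f => comp1m f)
    (fun A B D E h g f => esym (compA f g h)).

Lemma pushout_sym (C : category) (A B A' B' : C) (i : hom A B)
    (f : hom A A') (fbar : hom B B') (ibar : hom A' B') :
  is_pushout i f fbar ibar -> is_pushout f i ibar fbar.
Proof. exact: (@pullback_sym (opposite C)). Qed.

Lemma pushout_paste (C : category) (A B A1 A2 B1 B2 : C) (i : hom A B)
    (f : hom A A1) (g : hom A1 A2) (fbar : hom B B1) (ibar : hom A1 B1)
    (gbar : hom B1 B2) (ibar2 : hom A2 B2) :
  is_pushout i f fbar ibar -> is_pushout ibar g gbar ibar2 ->
  is_pushout i (g \c f) (gbar \c fbar) ibar2.
Proof. exact: (@pullback_paste (opposite C)). Qed.

Lemma pushout_cancel (C : category) (A B A1 A2 B1 B2 : C) (i : hom A B)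
    (f : hom A A1) (g : hom A1 A2) (fbar : hom B B1) (ibar : hom A1 B1)
    (h : hom B B2) (gbar : hom B1 B2) (ibar2 : hom A2 B2) :
  is_pushout i f fbar ibar -> is_pushout i (g \c f) h ibar2 ->
  gbar \c fbar = h -> gbar \c ibar = ibar2 \c g ->
  is_pushout ibar g gbar ibar2.
Proof. exact: (@pullback_cancel (opposite C)). Qed.

Lemma pushout_desc (C : category) (A B A' B' T : C) (i : hom A B)
    (f : hom A A') (fbar : hom B B') (ibar : hom A' B')
    (u : hom B T) (v : hom A' T) :
  is_pushout i f fbar ibar -> u \c i = v \c f ->
  exists w : hom B' T, w \c fbar = u /\ w \c ibar = v.
Proof. by move=> [_ univ] /univ [w [? _]]; exists w. Qed.

Lemma pushout_ext (C : category) (A B A' B' T : C) (i : hom A B)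
    (f : hom A A') (fbar : hom B B') (ibar : hom A' B') (w w' : hom B' T) :
  is_pushout i f fbar ibar -> w \c fbar = w' \c fbar ->
  w \c ibar = w' \c ibar -> w = w'.
Proof.
move=> [sq univ] e1 e2.
have [|x [_ xU]] := univ T (w \c fbar) (w \c ibar); first by rewrite -!compA sq.
by apply: etrans (esym (xU _ _)) (xU _ _).
Qed.

Lemma pullback_pair (C : category) (E B B' E' T : C) (p : hom E B)
    (f : hom B' B) (fbar : hom E' E) (pbar : hom E' B')
    (u : hom T E) (v : hom T B') :
  is_pullback p f fbar pbar -> p \c u = f \c v ->
  exists w : hom T E', fbar \c w = u /\ pbar \c w = v.
Proof. exact: (@pushout_desc (opposite C)). Qed.

End Pasting.

(** * Lifting from cofibrant objects and the gluing lemma *)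

Section JMCategoryTheory.
Variable C : jm_category.

Lemma idm_fib_cof_weq (A : C) : [/\ fib (idm A), cof (idm A) & weq (idm A)].
Proof. by apply: J1_iso; exists (idm A); rewrite comp1m. Qed.

Lemma cof_zero : cof (from0 (zero : C)).
Proof. by have [_ + _] := idm_fib_cof_weq (zero : C); rewrite (from0_unique (idm _)). Qed.

Lemma cofibrant_lift (A E B : C) (r : hom E B) (f : hom A B) :
  cof (from0 A) -> fib r -> weq r -> exists s : hom A E, r \c s = f.
Proof.
move=> cA fr wr; have [|s [_ sf]] := M1_lift (u := from0 E) (v := f) cA fr (or_intror wr).
  by rewrite [LHS]from0_unique [RHS]from0_unique.
by exists s.
Qed.

(** If [f] is a cofibration, [v] is a cobase extension of [w] along a cofibration. In general write
    [f] as a cofibration [c] followed by a weak equivalence [x]; replacing [c] by [f] changes both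
    push-outs by cobase extensions of [x], and two-out-of-three concludes. *)
Lemma gluing_under (A B B' X P P' : C) (i : hom A B) (i' : hom A B')
    (w : hom B B') (f : hom A X) (fbar : hom B P) (ibar : hom X P)
    (fbar' : hom B' P') (ibar' : hom X P') (v : hom P P') :
  cof i -> cof i' -> weq w -> w \c i = i' ->
  is_pushout i f fbar ibar -> is_pushout i' f fbar' ibar' ->
  v \c fbar = fbar' \c w -> v \c ibar = ibar' -> weq v.
Proof.
move=> ci ci' ww wi po po' vf vi.
have [X1 [c [x [fE cc _ wx]]]] := M2_fact_cof f.
have [P1 [c1 [i1 po1]]] := J2_pushout c ci.
have [P1' [c1' [i1' po1']]] := J2_pushout c ci'.
subst f.
have [|y [y1 y2]] := pushout_desc po1 (u := fbar) (v := ibar \c x).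
  by rewrite po.1 compA.
have [|y' [y1' y2']] := pushout_desc po1' (u := fbar') (v := ibar' \c x).
  by rewrite po'.1 compA.
have [|z [z1 z2]] := pushout_desc po1 (u := c1' \c w) (v := i1').
  by rewrite -compA wi po1'.1.
have [ci1 _ _] := J2_cobase_ext ci po1.
have [ci1' _ _] := J2_cobase_ext ci' po1'.
have wy : weq y.
  by have [_ + _] := J2_cobase_ext ci1 (pushout_cancel po1 po y1 y2); apply.
have wy' : weq y'.
  by have [_ + _] := J2_cobase_ext ci1' (pushout_cancel po1' po' y1' y2'); apply.
have wz : weq z.
  have po1s := pushout_sym po1.
  have po1s' : is_pushout c (w \c i) i1' c1' by rewrite wi; apply: pushout_sym.
  have [cc1 _ _] := J2_cobase_ext cc po1s.
  by have [_ + _] := J2_cobase_ext cc1 (pushout_cancel po1s po1s' z2 z1); apply.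
apply: (J1_weq_right wy).
suff -> : v \c y = y' \c z by apply: J1_weq_comp.
apply: (pushout_ext po1).
  by rewrite -!compA y1 z1 vf compA y1'.
by rewrite -!compA y2 z2 y2' compA vi.
Qed.

(** Push [i] forward along [a] to [i1], and let [Q] be the push-out of [i1] and [f']. Then [v]
    factors through [Q] as a cobase extension of [x] followed by a comparison covered by
    [gluing_under]. *)
Lemma gluing (A B X P A' B' X' P' : C)
    (i : hom A B) (f : hom A X) (fbar : hom B P) (ibar : hom X P)
    (i' : hom A' B') (f' : hom A' X') (fbar' : hom B' P') (ibar' : hom X' P')
    (a : hom A A') (b : hom B B') (x : hom X X') (v : hom P P') :
  cof i -> cof i' -> weq a -> weq b -> weq x ->
  b \c i = i' \c a -> x \c f = f' \c a ->
  is_pushout i f fbar ibar -> is_pushout i' f' fbar' ibar' ->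
  v \c fbar = fbar' \c b -> v \c ibar = ibar' \c x -> weq v.
Proof.
move=> ci ci' wa wb wx bi xf po po' vf vi.
have [B1 [beta [i1 po1]]] := J2_pushout a ci.
have [ci1 + _] := J2_cobase_ext ci po1 => /(_ wa) wbeta.
have [w [w1 w2]] := pushout_desc po1 bi.
have ww : weq w by apply: (J1_weq_right wbeta); rewrite w1.
have [Q [g [j poQ]]] := J2_pushout f' ci1.
have [cibar _ _] := J2_cobase_ext ci po.
have poQ' : is_pushout i (x \c f) (g \c beta) j.
  by rewrite xf; apply: pushout_paste po1 poQ.
have [|phi [phi1 phi2]] := pushout_desc po (u := g \c beta) (v := j \c x).
  by rewrite poQ'.1 compA.
have wphi : weq phi.
  by have [_ + _] := J2_cobase_ext cibar (pushout_cancel po poQ' phi1 phi2); apply.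
have [|psi [psi1 psi2]] := pushout_desc poQ (u := fbar' \c w) (v := ibar').
  by rewrite -compA w2 po'.1.
have wpsi := gluing_under ci1 ci' ww w2 poQ po' psi1 psi2.
suff -> : v = psi \c phi by apply: J1_weq_comp.
apply: (pushout_ext po); rewrite -compA.
  by rewrite phi1 compA psi1 -compA w1.
by rewrite phi2 compA psi2.
Qed.

(** * Calculus of weak liftings *)

Lemma weak_lifting_map (A B D : C) (g : hom D B) (s : hom A D) :
  weak_lifting (g \c s) g.
Proof.
have [E [t [p [gE _ wt fp]]]] := M2_fact_fib g.
by exists E, t, p; split=> //; exists (t \c s); rewrite compA gE.
Qed.

Lemma weak_lifting_weq (B D D' : C) (g : hom D B) (w : hom D' D) :
  weq w -> weak_lifting g (g \c w).
Proof.
move=> ww; have [E [t [p [gE _ wt fp]]]] := M2_fact_fib g.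
exists E, (t \c w), p; split; last by exists t.
by split=> //; [rewrite compA gE | apply: J1_weq_comp].
Qed.

Lemma weak_lifting_precomp (A' A B D : C) (f : hom A B) (g : hom D B)
    (h : hom A' A) : weak_lifting f g -> weak_lifting (f \c h) g.
Proof.
move=> [E [t [p [F [s sf]]]]]; exists E, t, p; split=> //.
by exists (s \c h); rewrite compA sf.
Qed.

Lemma weak_lifting_postcomp (A B D B' : C) (f : hom A B) (g : hom D B)
    (b : hom B B') : weak_lifting f g -> weak_lifting (b \c f) (b \c g).
Proof.
move=> [E [t [p [[-> wt fp] [s sf]]]]].
have [E' [t' [p' [bpE _ wt' fp']]]] := M2_fact_fib (b \c p).
exists E', (t' \c t), p'; split.
  by split=> //; [rewrite !compA bpE | apply: J1_weq_comp].
by exists (t' \c s); rewrite compA -bpE -compA sf.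
Qed.

(** Pull an F-factorization of [b \c g] back along [b]: the base extension of [b] is a weak
    equivalence, so the result is an F-factorization of [g]. *)
Lemma weak_lifting_cancel (A B D B' : C) (f : hom A B) (g : hom D B)
    (b : hom B B') :
  weq b -> weak_lifting (b \c f) (b \c g) -> weak_lifting f g.
Proof.
move=> wb [E [t [p [[bgE wt fp] [s sf]]]]].
have [E0 [bb [pb pbk]]] := J2_pullback b fp.
have [fpb + _] := J2_base_ext fp pbk => /(_ wb) wbb.
have [t0 [t01 t02]] := pullback_pair pbk (esym bgE).
have [s0 [s01 s02]] := pullback_pair pbk sf.
exists E0, t0, pb; split; last by exists s0.
by split=> //; apply: (J1_weq_left wbb); rewrite t01.
Qed.

(** For a cofibrant source the choice of F-factorization is immaterial. Split [t0] into a trivial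
    cofibration and a trivial fibration: the given lift passes through the latter, and [t] extends
    along the former. *)
Lemma weak_lifting_any (A B D E : C) (f : hom A B) (g : hom D B)
    (t : hom D E) (p : hom E B) :
  cof (from0 A) -> weak_lifting f g -> F_factorization g t p ->
  exists s : hom A E, p \c s = f.
Proof.
move=> cA [E0 [t0 [p0 [[gE0 wt0 fp0] [s0 sf]]]]] [gE wt fp].
have [W [c [r [t0E cc wc fr]]]] := M2_fact_fib t0.
have wr : weq r by apply: (J1_weq_right wc); rewrite -t0E.
have [s1 s1E] := cofibrant_lift s0 cA fr wr.
have [|d [_ dp]] := M1_lift (u := t) (v := p0 \c r) cc fp (or_introl wc).
  by rewrite -gE gE0 t0E compA.
by exists (d \c s1); rewrite compA dp -compA s1E.
Qed.

(* [A] and [D] need not be cofibrant: the lifts are glued along the mapping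
   cylinder [M] of [D -> E'] instead of being composed. *)
Lemma weak_lifting_trans (A B D D' : C) (f : hom A B) (g : hom D B)
    (h : hom D' B) :
  cof (from0 D') -> weak_lifting f g -> weak_lifting g h -> weak_lifting f h.
Proof.
move=> cD' [E [t [p [[gE wt fp] [s sf]]]]] [E' [t' [p' [[hE wt' fp'] [u ug]]]]].
have [M [c [r [uE cc fr wr]]]] := M2_fact_cof u.
have [S [tb [cb po]]] := J2_pushout t cc.
have [_ + _] := J2_cobase_ext cc po => /(_ wt) wtb.
have [|q [q1 q2]] := pushout_desc po (u := p' \c r) (v := p).
  by rewrite -compA -uE ug gE.
have [m mE] := cofibrant_lift t' cD' fr wr.
have wm : weq m by apply: (J1_weq_left wr); rewrite mE.
(* The leg [tb \c m] is a weak equivalence, so a fibration replacing [q] also replaces [h]; the lift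
   of [f] enters through the other leg [cb]. *)
have [S' [k [q' [qE _ wk fq']]]] := M2_fact_fib q.
exists S', (k \c (tb \c m)), q'; split.
  split=> //; last by do 2?[apply: J1_weq_comp].
  by rewrite hE compA -qE compA q1 -compA mE.
by exists (k \c (cb \c s)); rewrite compA -qE compA q2.
Qed.

(** * Joins with explicit choices *)

(* The choices entering a join, once the fibration [p] replacing the second
   map is fixed. *)
Record join_data (A B E J : C) (f : hom A B) (p : hom E B) (j : hom J B) :=
  JoinData {
  jfibre : C;
  jcyl : C;
  jfbar : hom jfibre E;
  jpbar : hom jfibre A;
  jcof : hom jfibre jcyl;
  jsigma : hom jcyl E;
  jinA : hom A J;
  jinZ : hom jcyl J;
  jpullback : is_pullback p f jfbar jpbar;
  jfact : C_factorization jfbar jcof jsigma;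
  jpushout : is_pushout jcof jpbar jinZ jinA;
  jmapA : j \c jinA = f;
  jmapZ : j \c jinZ = p \c jsigma
}.

Lemma is_joinP (A B D J : C) (f : hom A B) (g : hom D B) (j : hom J B) :
  is_join f g j -> exists (E : C) (t : hom D E) (p : hom E B),
    F_factorization g t p /\ inhabited (join_data f p j).
Proof.
move=> [E [t [p [F [fb [pb [Z [i [sg [inA [inZ [Fg pbk Cf po [jA jZ]]]]]]]]]]]]].
by exists E, t, p; split=> //; split; apply: (JoinData pbk Cf po jA jZ).
Qed.

Lemma is_join_of_data (A B D J E : C) (f : hom A B) (g : hom D B)
    (j : hom J B) (t : hom D E) (p : hom E B) :
  F_factorization g t p -> join_data f p j -> is_join f g j.
Proof.
move=> Fg [F Z fb pb i sg inA inZ pbk Cf po jA jZ].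
by exists E, t, p, F, fb, pb, Z, i, sg, inA, inZ.
Qed.

(** Choosing [jsigma] to be a fibration makes this join a convenient target: (M1) then produces maps
    into its cylinder. *)
Lemma join_data_exists (A B E : C) (f : hom A B) (p : hom E B) :
  fib p -> exists (J : C) (j : hom J B) (d : join_data f p j), fib (jsigma d).
Proof.
move=> fp; have [F [fb [pb pbk]]] := J2_pullback f fp.
have [Z [i [sg [fE ci fs ws]]]] := M2_fact_cof fb.
have [J [inZ [inA po]]] := J2_pushout pb ci.
have [|j [jZ jA]] := pushout_desc po (u := p \c sg) (v := f).
  by rewrite -compA -fE pbk.1.
have Cf : C_factorization fb i sg by [].
by exists J, j, (JoinData pbk Cf po jA jZ).
Qed.

Lemma join_data_cof (A B E J : C) (f : hom A B) (p : hom E B) (j : hom J B)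
  (d : join_data f p j) : cof (jinA d).
Proof.
have [_ ci _] := jfact d.
by have [] := J2_cobase_ext ci (jpushout d).
Qed.

Lemma join_data_cofibrant (A B E J : C) (f : hom A B) (p : hom E B)
    (j : hom J B) : cof (from0 A) -> join_data f p j -> cof (from0 J).
Proof.
move=> cA d; rewrite -(from0_unique (jinA d \c from0 A)).
exact: J1_cof_comp cA (join_data_cof d).
Qed.

Lemma is_join_cofibrant (A B D J : C) (f : hom A B) (g : hom D B)
    (j : hom J B) : cof (from0 A) -> is_join f g j -> cof (from0 J).
Proof.
by move=> cA /is_joinP[E [t [p [_ [d]]]]]; apply: join_data_cofibrant d.
Qed.

(** * Maps between joins and naturality up to weak lifting *)

(** The map of cylinders is a lift against the trivial fibration [jsigma d2]; it glues with [a], and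
    the gluing lemma detects weak equivalences. *)
Lemma join_data_map_fibre (A1 A2 B1 B2 E1 E2 J1 J2 : C)
    (f1 : hom A1 B1) (p1 : hom E1 B1) (j1 : hom J1 B1)
    (f2 : hom A2 B2) (p2 : hom E2 B2) (j2 : hom J2 B2)
    (d1 : join_data f1 p1 j1) (d2 : join_data f2 p2 j2)
    (a : hom A1 A2) (b : hom B1 B2) (e : hom E1 E2)
    (phi : hom (jfibre d1) (jfibre d2)) :
  fib (jsigma d2) -> f2 \c a = b \c f1 -> p2 \c e = b \c p1 ->
  jfbar d2 \c phi = e \c jfbar d1 -> jpbar d2 \c phi = a \c jpbar d1 ->
  exists w : hom J1 J2,
    j2 \c w = b \c j1 /\ (weq phi -> weq a -> weq e -> weq w).
Proof.
move=> fs fa pe phi1 phi2.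
have [fE1 ci1 ws1] := jfact d1; have [fE2 ci2 ws2] := jfact d2.
have [|z [zi zs]] := M1_lift (u := jcof d2 \c phi) (v := e \c jsigma d1)
    ci1 fs (or_intror ws2).
  by rewrite compA -fE2 phi1 -compA -fE1.
have [|w [w1 w2]] := pushout_desc (jpushout d1)
    (u := jinZ d2 \c z) (v := jinA d2 \c a).
  by rewrite -!compA zi -phi2 !compA (jpushout d2).1.
exists w; split=> [|wphi wa we].
  apply: (pushout_ext (jpushout d1)); rewrite -!compA.
    by rewrite w1 compA jmapZ -compA zs compA pe jmapZ compA.
  by rewrite w2 compA !jmapA.
apply: (gluing ci1 ci2 wphi _ wa zi (esym phi2) (jpushout d1) (jpushout d2) w1 w2).
by apply: (J1_weq_left ws2); rewrite zs; apply: J1_weq_comp.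
Qed.

Lemma join_data_map (A1 A2 B1 B2 E1 E2 J1 J2 : C)
    (f1 : hom A1 B1) (p1 : hom E1 B1) (j1 : hom J1 B1)
    (f2 : hom A2 B2) (p2 : hom E2 B2) (j2 : hom J2 B2)
    (d1 : join_data f1 p1 j1) (d2 : join_data f2 p2 j2)
    (a : hom A1 A2) (b : hom B1 B2) (e : hom E1 E2) :
  fib (jsigma d2) -> f2 \c a = b \c f1 -> p2 \c e = b \c p1 ->
  exists w : hom J1 J2, j2 \c w = b \c j1.
Proof.
move=> fs fa pe.
have [|phi [phi1 phi2]] := pullback_pair (jpullback d2)
    (u := e \c jfbar d1) (v := a \c jpbar d1).
  by rewrite !compA pe fa -!compA (jpullback d1).1.
by have [w []] := join_data_map_fibre fs fa pe phi1 phi2; exists w.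
Qed.

(** By pull-back cancellation, the map of fibres is a base extension of the trivial fibration
    [e]. *)
Lemma join_data_weq_fib (A B E1 E2 J1 J2 : C) (f : hom A B)
    (p2 : hom E2 B) (e : hom E1 E2) (j1 : hom J1 B) (j2 : hom J2 B)
    (d1 : join_data f (p2 \c e) j1) (d2 : join_data f p2 j2) :
  fib e -> weq e -> fib (jsigma d2) ->
  exists w : hom J1 J2, j2 \c w = j1 /\ weq w.
Proof.
move=> fe we fs.
have [|phi [phi1 phi2]] := pullback_pair (jpullback d2)
    (u := e \c jfbar d1) (v := jpbar d1).
  by rewrite compA (jpullback d1).1.
have wphi : weq phi.
  have [_ _] := J2_base_ext fe (pullback_sym (pullback_cancel
    (pullback_sym (jpullback d2)) (pullback_sym (jpullback d1)) phi2 phi1)).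
  exact.
have [_ _ wid] := idm_fib_cof_weq A.
have fE : f \c idm A = idm B \c f by rewrite comp1m compm1.
have pE : p2 \c e = idm B \c (p2 \c e) by rewrite comp1m.
have phi2' : jpbar d2 \c phi = idm A \c jpbar d1 by rewrite comp1m.
have [w [wj ww]] := join_data_map_fibre fs fE pE phi1 phi2'.
by exists w; split; [rewrite wj comp1m | apply: ww].
Qed.

(** Here the map of fibres is a base extension of [a] along the fibration [jpbar d2]. *)
Lemma join_data_weq_base (A1 A2 B E J1 J2 : C) (f : hom A2 B)
    (a : hom A1 A2) (p : hom E B) (j1 : hom J1 B) (j2 : hom J2 B)
    (d1 : join_data (f \c a) p j1) (d2 : join_data f p j2) :
  fib p -> weq a -> fib (jsigma d2) ->
  exists w : hom J1 J2, j2 \c w = j1 /\ weq w.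
Proof.
move=> fp wa fs.
have [|phi [phi1 phi2]] := pullback_pair (jpullback d2)
    (u := jfbar d1) (v := a \c jpbar d1).
  by rewrite compA (jpullback d1).1.
have wphi : weq phi.
  have [fpb _ _] := J2_base_ext fp (jpullback d2).
  have [_ + _] := J2_base_ext fpb (pullback_cancel (jpullback d2) (jpullback d1) phi1 phi2).
  exact.
have [_ _ wid] := idm_fib_cof_weq E.
have fE : f \c a = idm B \c (f \c a) by rewrite comp1m.
have pE : p \c idm E = idm B \c p by rewrite comp1m compm1.
have phi1' : jfbar d2 \c phi = idm E \c jfbar d1 by rewrite comp1m.
have [w [wj ww]] := join_data_map_fibre fs fE pE phi1' phi2.
by exists w; split; [rewrite wj comp1m | apply: ww].
Qed.

(** A single weak equivalence over [B], obtained for [e] the identity, yields both directions. *)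
Lemma join_data_weak_lifting (A B E J J' : C) (f : hom A B) (p : hom E B)
    (j : hom J B) (j' : hom J' B) (d : join_data f p j)
    (d' : join_data f p j') :
  fib (jsigma d') -> weak_lifting j j' /\ weak_lifting j' j.
Proof.
move=> fs; have [fid _ wid] := idm_fib_cof_weq E.
have d1 : join_data f (p \c idm E) j by rewrite compm1.
have [w [<- ww]] := join_data_weq_fib d1 fid wid fs.
by split; [apply: weak_lifting_map | apply: weak_lifting_weq].
Qed.

Lemma join_natural (A B B' D D' J J' : C) (f : hom A B) (g : hom D B)
    (j : hom J B) (f' : hom A B') (g' : hom D' B') (j' : hom J' B')
    (b : hom B B') :
  cof (from0 A) -> cof (from0 D) -> f' = b \c f ->
  is_join f g j -> is_join f' g' j' ->
  weak_lifting (b \c g) g' -> weak_lifting (b \c j) j'.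
Proof.
move=> cA cD fE /is_joinP[E [t [p [[gE wt fp] [d]]]]].
move=> /is_joinP[E' [t' [p' [Fg' [d']]]]] bg.
have fp' : fib p' by case: Fg'.
have [h hE] := weak_lifting_any cD bg Fg'.
(* A map out of [D] extends along a trivial cofibration, whereas [t] is only a weak equivalence; so
   [E] is replaced by [E1], at the cost of comparing the joins over [r]. *)
have [E1 [t1 [r [tE ct1 wt1 fr]]]] := M2_fact_fib t.
have wr : weq r by apply: (J1_weq_right wt1); rewrite -tE.
have [|e [_ pe]] := M1_lift (u := h) (v := b \c (p \c r)) ct1 fp' (or_introl wt1).
  by rewrite hE gE tE !compA.
have [J1 [j1 [d1 _]]] := join_data_exists f (J1_fib_comp fr fp).
have [J2 [j2 [d2 fs2]]] := join_data_exists f fp.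
have [J3 [j3 [d3 fs3]]] := join_data_exists f' fp'.
have [jj2 _] := join_data_weak_lifting d fs2.
have [_ j3j'] := join_data_weak_lifting d' fs3.
have [w12 [w12E ww12]] := join_data_weq_fib d1 fr wr fs2.
have [|w13 w13E] := join_data_map (a := idm A) d1 fs3 _ pe; first by rewrite compm1.
apply: weak_lifting_trans (weak_lifting_postcomp b jj2) _.
  exact: join_data_cofibrant cA d'.
apply: weak_lifting_trans (weak_lifting_postcomp b (weak_lifting_weq j2 ww12)) _.
  exact: join_data_cofibrant cA d'.
apply: weak_lifting_trans _ j3j'; first exact: join_data_cofibrant cA d'.
by rewrite w12E -w13E; apply: weak_lifting_map.
Qed.

Lemma weak_lifting_refl (B D : C) (g : hom D B) : weak_lifting g g.
Proof. by rewrite -[X in weak_lifting X]compm1; apply: weak_lifting_map. Qed.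

Lemma join_natural_base (A B D D' J J' : C) (f : hom A B) (g : hom D B)
    (j : hom J B) (g' : hom D' B) (j' : hom J' B) :
  cof (from0 A) -> cof (from0 D) -> is_join f g j -> is_join f g' j' ->
  weak_lifting g g' -> weak_lifting j j'.
Proof.
move=> cA cD Jj Jj' gg'; rewrite -[j]comp1m.
by apply: join_natural Jj Jj' _; rewrite ?comp1m.
Qed.

(** Pull a fibration [p] replacing [b \c g] back to [pb] over [B]. By pasting, a join of [f] with
    [pb] composed with [b] is a join of [b \c f] with [b \c g]; naturality over a fixed base does
    the rest. *)
Lemma join_weq (A B B' D D' J J' : C) (f : hom A B) (g : hom D B)
    (j : hom J B) (g' : hom D' B') (j' : hom J' B') (b : hom B B') :
  cof (from0 A) -> cof (from0 D) -> cof (from0 D') -> weq b ->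
  is_join f g j -> is_join (b \c f) g' j' ->
  weak_lifting g' (b \c g) -> weak_lifting j' (b \c j).
Proof.
move=> cA cD cD' wb Jj Jj' g'bg.
have [E [t [p [bgE _ wt fp]]]] := M2_fact_fib (b \c g).
have [E0 [bb [pb pbk]]] := J2_pullback b fp.
have [fpb + _] := J2_base_ext fp pbk => /(_ wb) wbb.
have [t0 [t01 t02]] := pullback_pair pbk (esym bgE).
have Fg : F_factorization g t0 pb.
  by split=> //; apply: (J1_weq_left wbb); rewrite t01.
have [J0 [j0 [d0 _]]] := join_data_exists f fpb.
have Jj0 := is_join_of_data Fg d0.
have Jbj0 : is_join (b \c f) (b \c g) (b \c j0).
  case: d0 Jj0 => F Z fb pbr i sg inA inZ pbk0 [fbE ci ws] po jA jZ _.
  have Cf : C_factorization (bb \c fb) i (bb \c sg).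
    by split; rewrite ?fbE ?compA //; apply: J1_weq_comp.
  have bjA : b \c j0 \c inA = b \c f by rewrite -compA jA.
  have bjZ : b \c j0 \c inZ = p \c (bb \c sg).
    by rewrite -compA jZ !compA pbk.1.
  have Fbg : F_factorization (b \c g) t p by [].
  exact: is_join_of_data Fbg
    (JoinData (pullback_paste pbk pbk0) Cf po bjA bjZ).
apply: weak_lifting_trans (is_join_cofibrant cA Jj) _ (weak_lifting_postcomp b _).
  exact: join_natural_base cA cD' Jj' Jbj0 g'bg.
exact: join_natural_base cA cD Jj0 Jj (weak_lifting_refl g).
Qed.

(** * Ganea maps and the behaviour of cat *)

Section Ganea.
Variable K : join_choice C.

Lemma ganea_is_join (B : C) (n : nat) :
  is_join (from0 B) (ganea_map K B n) (ganea_map K B n.+1).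
Proof. exact: join_mapP. Qed.

Lemma ganea_cofibrant (B : C) (n : nat) : cof (from0 (ganea_obj K B n)).
Proof.
case: n => [|n]; first exact: cof_zero.
exact: is_join_cofibrant (cof_zero) (ganea_is_join B n).
Qed.

Lemma ganea_natural (B B' : C) (b : hom B B') (n : nat) :
  weak_lifting (b \c ganea_map K B n) (ganea_map K B' n).
Proof.
elim: n => [|n IHn].
  have -> : b \c ganea_map K B 0 = ganea_map K B' 0 by apply: from0_unique.
  exact: weak_lifting_refl.
apply: join_natural cof_zero (ganea_cofibrant B n) _
  (ganea_is_join B n) (ganea_is_join B' n) IHn.
by rewrite [RHS]from0_unique.
Qed.

Lemma ganea_weq (B B' : C) (b : hom B B') (n : nat) :
  weq b -> weak_lifting (ganea_map K B' n) (b \c ganea_map K B n).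
Proof.
move=> wb; elim: n => [|n IHn].
  have -> : b \c ganea_map K B 0 = ganea_map K B' 0 by apply: from0_unique.
  exact: weak_lifting_refl.
apply: join_weq (cof_zero) (ganea_cofibrant B n) (ganea_cofibrant B' n) wb
  (ganea_is_join B n) _ IHn.
by rewrite (from0_unique (b \c _)); apply: ganea_is_join.
Qed.

Lemma weak_lifting_idm_weq (A B : C) (w : hom A B) :
  weq w -> weak_lifting (idm B) w.
Proof. by move=> ww; rewrite -[w]comp1m; apply: weak_lifting_weq. Qed.

(** Writing [<=] for weak lifting and [p] for Ganea maps: [idm B' <= b <= b \c p_B <= p_B']. *)
Lemma cat_le_weq_target (B B' : C) (b : hom B B') (n : nat) :
  weq b -> cat_le K B n -> cat_le K B' n.
Proof.
move=> wb /(weak_lifting_postcomp b); rewrite compm1 => h.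
have cG := ganea_cofibrant B' n.
apply: (weak_lifting_trans cG (weak_lifting_idm_weq wb) _).
exact: weak_lifting_trans cG h (ganea_natural b n).
Qed.

(** From [idm B' <= p_B' <= b \c p_B], precomposing with [b] gives [b <= b \c p_B], and [b]
    cancels. *)
Lemma cat_le_weq_source (B B' : C) (b : hom B B') (n : nat) :
  weq b -> cat_le K B' n -> cat_le K B n.
Proof.
move=> wb h.
have {}h := weak_lifting_trans (ganea_cofibrant B n) h (ganea_weq n wb).
have := weak_lifting_precomp b h; rewrite comp1m => {}h.
by apply: (weak_lifting_cancel wb); rewrite compm1.
Qed.

(** The chain is [i <= al <= al \c p_Q <= p_R <= i \c p_X], after which [i] cancels. *)
Lemma cat_le_dominates (D X : C) (n : nat) :
  dominates D X -> cat_le K D n -> cat_le K X n.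
Proof.
move=> [Q [q [R [i [[cQ _ wq] [_ wi _] [al ial]]]]]] /(cat_le_weq_source wq) h.
have := weak_lifting_postcomp al h; rewrite compm1 => {}h.
have cR := ganea_cofibrant R n; have cX := ganea_cofibrant X n.
have {}h := weak_lifting_trans cR h (ganea_natural al n).
have {}h := weak_lifting_trans cR ial h.
have {}h := weak_lifting_trans cX h (ganea_weq n wi).
by apply: (weak_lifting_cancel wi); rewrite compm1.
Qed.

(* When [f] is a cofibration, a lift [Y -> E] of [p] to a fibration replacing
   the Ganea map yields a section of the join of [CA -> D] with [E -> D]; this
   join agrees with that of [zero -> D] because [CA] is contractible. *)
Lemma cat_le_cofibre_cof (A Y D : C) (f : hom A Y) (p : hom Y D) (n : nat) :
  cof f -> is_cofibre_sequence f p -> cat_le K Y n -> cat_le K D n.+1.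
Proof.
move=> cf [CA [k [e [fb [[_ ck we] po]]]]] hY.
have := weak_lifting_postcomp p hY; rewrite compm1 => hp.
have [E [t [r [Fg [s sE]]]]] :=
  weak_lifting_trans (ganea_cofibrant D n) hp (ganea_natural p n).
have fr : fib r by case: Fg.
have [J [j [d fs]]] := join_data_exists fb fr.
have [J0 [j0 [d0 _]]] := join_data_exists (from0 D) fr.
have [fE ci ws] := jfact d.
have [|m [m1 m2]] := pullback_pair (jpullback d) (u := s \c f) (v := k).
  by rewrite compA sE po.1.
(* Since [f] is a cofibration, [jcof d \c m] extends over [Y] to a map into the cylinder that covers
   [s]; on [A] it agrees with [jinA d \c k] in the join. *)
have [|z [zf zs]] := M1_lift (u := jcof d \c m) (v := s) cf fs (or_intror ws).
  by rewrite compA -fE m1.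
have [|l [l1 l2]] := pushout_desc po (u := jinA d) (v := jinZ d \c z).
  by rewrite -compA zf compA (jpushout d).1 -compA m2.
have jl : j \c l = idm D.
  apply: (pushout_ext po); rewrite -compA comp1m.
    by rewrite l1 jmapA.
  by rewrite l2 compA jmapZ -compA zs sE.
(* Two-out-of-three: followed by [e], this map is the identity of [zero]. *)
have w0 : weq (from0 CA).
  have [_ _ wid] := idm_fib_cof_weq (zero : C).
  apply: (J1_weq_left we); rewrite [_ \c _]from0_unique -(from0_unique (idm _)).
  exact: wid.
have d0' : join_data (fb \c from0 CA) r j0 by rewrite (from0_unique (fb \c _)).
have [w [wE ww]] := join_data_weq_base d0' fr w0 fs.
have jj0 : weak_lifting j j0 by rewrite -wE; apply: weak_lifting_weq.
have j0g := join_natural_base cof_zero (ganea_cofibrant D n)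
  (is_join_of_data Fg d0) (ganea_is_join D n) (weak_lifting_refl _).
have cG := ganea_cofibrant D n.+1.
rewrite /cat_le /weak_section -jl.
apply: (weak_lifting_trans cG (weak_lifting_map j l) _).
exact: weak_lifting_trans cG jj0 j0g.
Qed.

(** Replace [f] by a cofibration [f'] into [Y']. The induced map of cofibres is a cobase extension
    of [y] along [p'], hence a weak equivalence. *)
Lemma cat_le_cofibre (A Y D : C) (f : hom A Y) (p : hom Y D) (n : nat) :
  is_cofibre_sequence f p -> cat_le K Y n -> cat_le K D n.+1.
Proof.
move=> [CA [k [e [fb [[kE ck we] po]]]]] hY.
have [Y' [f' [y [fE cf' _ wy]]]] := M2_fact_cof f; subst f.
have [D' [fb' [p' po']]] := J2_pushout f' ck.
have [cp' _ _] := J2_cobase_ext ck po'.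
have [|d [d1 d2]] := pushout_desc po' (u := fb) (v := p \c y).
  by rewrite po.1 compA.
have [_ + _] := J2_cobase_ext cp' (pushout_cancel po' po d1 d2) => /(_ wy) wd.
apply: (cat_le_weq_target wd).
have cs : is_cofibre_sequence f' p' by exists CA, k, e, fb'.
exact: cat_le_cofibre_cof cf' cs (cat_le_weq_source wy hY).
Qed.

Lemma indcat_le_cat_le (X : C) (n : nat) : indcat_le X n -> cat_le K X n.
Proof.
elim: n X => [|n IHn] X //= [A [Y [D [f [p [cs /IHn hY dX]]]]]].
exact: cat_le_dominates dX (cat_le_cofibre cs hY).
Qed.

End Ganea.

(** * Domination and indcat under weak equivalence *)

(** As [R'] is fibrant, [i' \c w] extends along [i] to some [r]; then
    [i' <= i' \c w = r \c i <= r \c al]. *)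
Lemma dominates_weq_target (D Y Y' : C) (w : hom Y Y') :
  weq w -> dominates D Y -> dominates D Y'.
Proof.
move=> ww [Q [q [R [i [Qq [ci wi fR] [al ial]]]]]].
have [R' [i' [r' [_ ci' wi' fr']]]] := M2_fact_fib (to0 Y').
rewrite (to0_unique r') in fr'.
have [|r [rE _]] := M1_lift (u := i' \c w) (v := to0 R) ci fr' (or_introl wi).
  by rewrite [LHS]to0_unique [RHS]to0_unique.
exists Q, q, R', i'; split=> //; exists (r \c al).
have [cQ _ _] := Qq.
apply: weak_lifting_trans cQ (weak_lifting_weq i' ww) _.
by rewrite -rE; apply: weak_lifting_postcomp.
Qed.

(** The induced [r : R' -> R] points the wrong way, so it is inverted weakly: for [r = v \c t], [al]
    lifts through the trivial fibration [v] because [Q] is cofibrant, and [t] has a retraction [rho]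
    because [R'] is fibrant. *)
Lemma dominates_weq_source (D Y Y' : C) (w : hom Y' Y) :
  weq w -> dominates D Y -> dominates D Y'.
Proof.
move=> ww [Q [q [R [i [Qq [_ wi fR] [al ial]]]]]].
have [cQ _ _] := Qq.
have [R' [i' [r' [_ ci' wi' fr']]]] := M2_fact_fib (to0 Y').
rewrite (to0_unique r') in fr'.
have [|r [rE _]] := M1_lift (u := i \c w) (v := to0 R') ci' fR (or_introl wi').
  by rewrite [LHS]to0_unique [RHS]to0_unique.
have wr : weq r by apply: (J1_weq_right wi'); rewrite rE; apply: J1_weq_comp.
have [W [t [v [rtE ct wt fv]]]] := M2_fact_fib r.
have wv : weq v by apply: (J1_weq_right wt); rewrite -rtE.
have [be beE] := cofibrant_lift al cQ fv wv.
have [|rho [rhoE _]] := M1_lift (u := idm R') (v := to0 W) ct fr' (or_introl wt).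
  by rewrite [LHS]to0_unique [RHS]to0_unique.
exists Q, q, R', i'; split=> //; exists (rho \c be).
rewrite -[i']comp1m -rhoE -compA; apply: weak_lifting_postcomp.
apply: (weak_lifting_cancel wv); rewrite compA -rtE rE beE.
exact: weak_lifting_precomp.
Qed.

(** No induction is required: for positive [n] the object enters only through the domination
    clause. *)
Lemma indcat_le_weq_target (Y Y' : C) (w : hom Y Y') (n : nat) :
  weq w -> indcat_le Y n -> indcat_le Y' n.
Proof.
move=> ww; case: n => [|n] /=; last first.
  move=> [A [Z [D [f [p [cs hZ dY]]]]]]; exists A, Z, D, f, p; split=> //.
  exact: dominates_weq_target ww dY.
move=> /(weak_lifting_postcomp w); rewrite compm1 (from0_unique (w \c _)).
exact: weak_lifting_trans cof_zero (weak_lifting_idm_weq ww).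
Qed.

Lemma indcat_le_weq_source (Y Y' : C) (w : hom Y' Y) (n : nat) :
  weq w -> indcat_le Y n -> indcat_le Y' n.
Proof.
move=> ww; case: n => [|n] /=; last first.
  move=> [A [Z [D [f [p [cs hZ dY]]]]]]; exists A, Z, D, f, p; split=> //.
  exact: dominates_weq_source ww dY.
move=> h; have := weak_lifting_precomp w h; rewrite comp1m => {}h.
by apply: (weak_lifting_cancel ww); rewrite compm1 (from0_unique (w \c _)).
Qed.

(** Take [alpha] to be [Q -> D -> J -> X -> R]; its part [Q -> J] is a weak equivalence, so
    [i <= i \c g <= alpha]. *)
Lemma weak_section_dominates (D J X : C) (w : hom D J) (g : hom J X) :
  weq w -> weak_section g -> dominates D X.
Proof.
move=> ww h; have [Q [q0 [q [_ cq fq wq]]]] := M2_fact_cof (from0 D).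
rewrite (from0_unique q0) in cq.
have [R [i [r [_ ci wi fr]]]] := M2_fact_fib (to0 X).
rewrite (to0_unique r) in fr.
exists Q, q, R, i; split=> //; exists (i \c g \c (w \c q)).
have := weak_lifting_postcomp i h; rewrite compm1 => {}h.
apply: weak_lifting_trans cq h (weak_lifting_weq _ _).
exact: J1_weq_comp.
Qed.

(* The join of [zero -> B] with [g] is the cofibre of the inclusion of the
   fibre of [g]. *)
Lemma indcat_le_join (B G J T : C) (g : hom G B) (j : hom J B) (t : hom J T)
    (n : nat) :
  is_join (from0 B) g j -> indcat_le G n -> weak_section t ->
  indcat_le T n.+1.
Proof.
move=> Jj hG ht; have cJ := is_join_cofibrant cof_zero Jj.
have [E [tau [p [[_ wtau _] [d]]]]] := is_joinP Jj.
have [_ ci ws] := jfact d.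
have hZ := indcat_le_weq_source ws (indcat_le_weq_target wtau hG).
have [CA [k [e [kE ck _ we]]]] := M2_fact_cof (to0 (jfibre d)).
have [D [fb [pD po]]] := J2_pushout (jcof d) ck.
have [cfb _ _] := J2_cobase_ext ci (pushout_sym po).
(* Read [J] as a push-out along [e \c k]: then [D -> J] is the cobase extension of [e] along the
   cofibration [fb], a weak equivalence. *)
have poJ : is_pushout (jcof d) (e \c k) (jinZ d) (jinA d).
  by rewrite -kE -(to0_unique (jpbar d)); apply: jpushout.
have [|u [u1 u2]] := pushout_desc po (u := jinA d \c e) (v := jinZ d).
  by rewrite poJ.1 compA.
have [_ + _] := J2_cobase_ext cfb (pushout_cancel (pushout_sym po) poJ u2 u1).
move=> /(_ we) wu.
exists (jfibre d), (jcyl d), D, (jcof d), pD; split=> //.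
  by exists CA, k, e, fb.
exact: weak_section_dominates wu ht.
Qed.

(** * Comparison of the two invariants *)

Lemma weak_section_idm (B : C) : weak_section (idm B).
Proof. exact: weak_lifting_refl. Qed.

Lemma indcat_le_ganea (K : join_choice C) (B : C) (n : nat) :
  indcat_le (ganea_obj K B n) n.
Proof.
elim: n => [|n IHn].
  by rewrite /= -(from0_unique (idm _)); apply: weak_section_idm.
exact: indcat_le_join (ganea_is_join K B n) IHn (weak_section_idm _).
Qed.

Lemma cat_le_indcat_le (K : join_choice C) (X : C) (n : nat) :
  cat_le K X n -> indcat_le X n.
Proof.
(* In degree zero both conditions say that [from0 X] has a weak section; above that,
   [indcat_le_join] applies with the Ganea map as [t]. *)
case: n => [//|n].
exact: indcat_le_join (ganea_is_join K X n) (indcat_le_ganea K X n).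
Qed.

End JMCategoryTheory.

Theorem theorem2p6 (C : jm_category) (K : join_choice C) (X : C) :
  indcat X = cat K X.
Proof.
congr (least _); apply/funext => n; apply/propext; split.
  exact: indcat_le_cat_le.
exact: cat_le_indcat_le.
Qed.
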